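(* Let $\varphi=\frac{1+\sqrt5}2$ and set \[ \alpha=\varphi-1,\qquad x_1=\frac{\varphi+\sqrt{13-7\varphi}}{2},\qquad y_1=\frac1{x_1-1}. \] Let $A_0$ be the deterministic online algorithm that leaves each arriving job $J_j$ untested if $r_j\le\varphi$ and tests it otherwise, always assigning it to a currently least loaded machine; let $A_1$ be the deterministic online algorithm that leaves $J_j$ untested if $r_j\le x_1$ or $\varphi<r_j\le y_1$ and tests it otherwise, always assigning it to a currently least loaded machine. Let $A$ be the randomized algorithm that runs $A_0$ with probability $\alpha$ and $A_1$ with probability $1-\alpha$. Then for the online scheduling with testing problem on $m=2$ machines, the expected competitive ratio of $A$ is at most $\frac{3\varphi+3\sqrt{13-7\varphi}}{4}$, and this bound is tight: there is an instance $I$ with $E[C^A(I)]/C^*(I)=\frac{3\varphi+3\sqrt{13-7\varphi}}{4}$.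
   Context: Online multiprocessor scheduling with testing on $m$ identical parallel machines: jobs $J_1,\dots,J_n$ arrive one by one in this order. When $J_j$ arrives, an upper bound $u_j\ge0$ and a testing time $t_j\ge0$ are revealed; its processing time $p_j\in[0,u_j]$ is unknown. Upon arrival the algorithm must irrevocably decide whether to test $J_j$ and on which machine to process it. An untested job occupies its machine for $u_j$ time; a tested job occupies it for $t_j+p_j$ time, and $p_j$ is revealed after testing. Processing is non-preemptive; the load of a machine is the total time of the jobs assigned to it, and the makespan $C$ is the maximum machine load. A least loaded machine is one of minimum current load (ties broken arbitrarily). Let $\rho_j=\min\{u_j,t_j+p_j\}$; the optimal offline makespan $C^*(I)$ is the minimum, over all assignments of jobs to machines, of the maximum over machines of the sum of $\rho_j$ over jobs assigned to it. A randomized algorithm is a probability distribution over deterministic algorithms; its expected competitive ratio is $\sup_I E[C(I)]/C^*(I)$. The ratio of a job is $r_j=u_j/t_j$ (with $r_j=+\infty$ if $t_j=0<u_j$, and $r_j=0$ if $u_j=t_j=0$). *)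

(* Defs.v *)
From HB Require Import structures.
From mathcomp Require Import all_boot all_order all_algebra.
From mathcomp Require Import all_classical all_reals all_analysis.
From mathcomp Require Import lra.

Set Implicit Arguments.
Unset Strict Implicit.
Unset Printing Implicit Defensive.

Import Order.TTheory GRing.Theory Num.Theory.
Import numFieldNormedType.Exports.

Local Open Scope classical_set_scope.
Local Open Scope ring_scope.

(* Upper bound u_j, testing time t_j and (hidden) processing time p_j. *)
Record job (R : realType) : Type := Job {
  job_u : R;
  job_t : R;
  job_p : R;
  job_u_ge0 : 0 <= job_u;
  job_t_ge0 : 0 <= job_t;
  job_p_bounds : 0 <= job_p <= job_u }.

(* What an online algorithm knows about a job it has already scheduled.  The
   processing time is observed ([Some p]) exactly when the job was tested;
   [None] means that the job was run untested. *)
Record scheduled_job (R : realType) (m : nat) : Type := ScheduledJob {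
  sched_u : R;
  sched_t : R;
  sched_p : option R;
  sched_machine : 'I_m }.

Definition occupied_time (R : realType) (m : nat) (s : scheduled_job R m) : R :=
  if sched_p s is Some p then sched_t s + p else sched_u s.

(* Scheduled jobs are listed in order of arrival. *)
Definition history (R : realType) (m : nat) : Type := seq (scheduled_job R m).

Definition load (R : realType) (m : nat) (h : history R m) (i : 'I_m) : R :=
  \sum_(s <- h | sched_machine s == i) occupied_time s.

(* From the history and the revealed pair (u_j, t_j), decide whether to test the
   arriving job ([true] = test) and on which machine to process it. *)
Definition online_algorithm (R : realType) (m : nat) : Type :=
  history R m -> R -> R -> bool * 'I_m.

Definition schedule_job (R : realType) (m : nat) (alg : online_algorithm R m)
    (h : history R m) (J : job R) : history R m :=
  let: (test, i) := alg h (job_u J) (job_t J) in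
  rcons h (ScheduledJob (job_u J) (job_t J)
             (if test then Some (job_p J) else None) i).

Definition run (R : realType) (m : nat) (alg : online_algorithm R m)
    (I : seq (job R)) : history R m :=
  foldl (schedule_job alg) [::] I.

Definition makespan (R : realType) (m : nat) (alg : online_algorithm R m)
    (I : seq (job R)) : R :=
  \big[Num.max/0]_(i < m) load (run alg I) i.

Definition job_rho (R : realType) (J : job R) : R :=
  Num.min (job_u J) (job_t J + job_p J).

Definition assignment_makespan (R : realType) (m : nat) (I : seq (job R))
    (a : {ffun 'I_(size I) -> 'I_m}) : R :=
  \big[Num.max/0]_(i < m)
    \sum_(j < size I | a j == i) job_rho (tnth (in_tuple I) j).

(* There are finitely many assignments, so for m > 0 the infimum is a minimum. *)
Definition optimal_makespan (R : realType) (m : nat) (I : seq (job R)) : R :=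
  inf [set assignment_makespan a | a in [set: {ffun 'I_(size I) -> 'I_m}]].

(* A probability distribution over deterministic algorithms, given as a family
   of deterministic algorithms indexed by a probability space. *)
Record randomized_algorithm (R : realType) (m : nat) : Type :=
  RandomizedAlgorithm {
    rand_display : measure_display;
    rand_space : measurableType rand_display;
    rand_prob : probability rand_space R;
    rand_alg : rand_space -> online_algorithm R m;
    rand_measurable : forall I : seq (job R),
      measurable_fun [set: rand_space] (fun w => makespan (rand_alg w) I) }.

Definition expected_makespan (R : realType) (m : nat)
    (A : randomized_algorithm R m) (I : seq (job R)) : \bar R :=
  ('E_(rand_prob A)[fun w => makespan (@rand_alg R m A w) I])%E.

(* The division is the one of [\bar R]: if the optimum is 0, the quotient is
   [+oo] when the expected makespan is positive, and 0 when it is 0. *)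
Definition performance_ratio (R : realType) (m : nat)
    (A : randomized_algorithm R m) (I : seq (job R)) : \bar R :=
  (expected_makespan A I / (optimal_makespan m I)%:E)%E.

Definition expected_competitive_ratio (R : realType) (m : nat)
    (A : randomized_algorithm R m) : \bar R :=
  ereal_sup [set performance_ratio A I | I in [set: seq (job R)]].

Definition job_ratio (R : realType) (u t : R) : \bar R :=
  if t == 0 then (if 0 < u then +oo%E else 0%E) else (u / t)%:E.

(* The machine selected for an arriving job with data u, t.  A rule also fixes
   how ties between least loaded machines are broken. *)
Definition machine_rule (R : realType) (m : nat) : Type :=
  history R m -> R -> R -> 'I_m.

Definition least_loaded_rule (R : realType) (m : nat)
    (sel : machine_rule R m) : Prop :=
  forall (h : history R m) (u t : R) (i : 'I_m), load h (sel h u t) <= load h i.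

Definition golden_ratio (R : realType) : R := (1 + Num.sqrt 5) / 2.

Definition alpha (R : realType) : R := golden_ratio R - 1.

Definition x1 (R : realType) : R :=
  (golden_ratio R + Num.sqrt (13 - 7 * golden_ratio R)) / 2.

Definition y1 (R : realType) : R := (x1 R - 1)^-1.

Definition algorithm_A0 (R : realType) (m : nat) (sel : machine_rule R m) :
    online_algorithm R m :=
  fun h u t =>
    let r := job_ratio u t in
    let untested := (r <= (golden_ratio R)%:E)%E in
    (~~ untested, sel h u t).

Definition algorithm_A1 (R : realType) (m : nat) (sel : machine_rule R m) :
    online_algorithm R m :=
  fun h u t =>
    let r := job_ratio u t in
    let untested :=
      ((r <= (x1 R)%:E) || ((golden_ratio R)%:E < r <= (y1 R)%:E))%E in
    (~~ untested, sel h u t).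

Lemma measurable_makespan_bool (R : realType) (m : nat)
    (alg : bool -> online_algorithm R m) (I : seq (job R)) :
  measurable_fun [set: bool] (fun b => makespan (alg b) I).
Proof. by []. Qed.

Lemma alpha_itv (R : realType) : 0 <= alpha R <= 1.
Proof.
have h1 : 1 <= Num.sqrt 5 :> R by rewrite -[leLHS]sqrtr1 ler_wsqrtr ?ler1n.
have h3 : Num.sqrt 5 <= 3 :> R.
  by rewrite -[leRHS]ger0_norm// -sqrtr_sqr ler_wsqrtr// -natrX ler_nat.
rewrite /alpha /golden_ratio subr_ge0 lerBlDr ler_pdivlMr// ler_pdivrMr//.
by apply/andP; split; lra.
Qed.

(* [bernoulli_prob p] gives mass p to [true] and 1 - p to [false], provided that
   p lies in [0, 1]; see [alpha_itv]. *)
Definition algorithm_A (R : realType) (m : nat) (sel0 sel1 : machine_rule R m) :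
    randomized_algorithm R m :=
  @RandomizedAlgorithm R m _ bool (bernoulli_prob (alpha R))
    (fun b => if b then algorithm_A0 sel0 else algorithm_A1 sel1)
    (measurable_makespan_bool _).

(* Main.v *)
Require Import Defs.
From mathcomp Require Import all_boot all_order all_algebra.
From mathcomp Require Import all_classical all_reals all_analysis.
From mathcomp Require Import ring lra.
Import Order.TTheory GRing.Theory Num.Theory.
Local Open Scope ring_scope.

Set Implicit Arguments.
Unset Strict Implicit.
Unset Printing Implicit Defensive.

(* List scheduling on two machines gives [2 * C <= q_1 + ... + q_l + q_l], where
   [q_j] is the time job [j] occupies and [l] is the job completing last on the
   most loaded machine.  Every job satisfies [E q_j <= x1 * rho_j], so if both
   algorithms have the same critical job [l], then [2 * E C <= 3 * x1 * C^*].
   If the critical jobs differ, single costs are only bounded by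
   [alpha * q_j <= rho_j] under [A0] and
   [(1 - alpha) * q_j <= (x1 - alpha) * rho_j] under [A1]; but the later critical
   job is missing from the sum of one of the algorithms, which more than
   compensates.  The bound is attained on three untested jobs with [u = x1 * t]
   and [p = 0], of testing times 1, 1 and 2. *)

(** * List scheduling under an arbitrary testing rule *)

Definition job_cost (R : realType) (test : R -> R -> bool) (J : job R) : R :=
  if test (job_u J) (job_t J) then job_t J + job_p J else job_u J.

Definition list_algorithm (R : realType) (m : nat) (test : R -> R -> bool)
    (sel : machine_rule R m) : online_algorithm R m :=
  fun h u t => (test u t, sel h u t).

Lemma job_cost_ge0 (R : realType) (test : R -> R -> bool) (J : job R) :
  0 <= job_cost test J.
Proof.
case: J => u t p u0 t0 p0; rewrite /job_cost /=; case: ifP => _ //.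
by case/andP: p0 => p0 _; exact: addr_ge0.
Qed.

Lemma job_rho_ge0 (R : realType) (J : job R) : 0 <= job_rho J.
Proof.
case: J => u t p u0 t0 p0; rewrite /job_rho /= le_min u0 /=.
by case/andP: p0 => p0 _; exact: addr_ge0.
Qed.

Lemma makespan_ge0 (R : realType) (m : nat) (alg : online_algorithm R m)
    (I : seq (job R)) : 0 <= makespan alg I.
Proof. exact: bigmax_ge_id. Qed.

Lemma load_le_makespan (R : realType) (m : nat) (alg : online_algorithm R m)
    (I : seq (job R)) (i : 'I_m) : load (run alg I) i <= makespan alg I.
Proof. exact: (le_bigmax _ (fun i => load (run alg I) i)). Qed.

Lemma run_rcons (R : realType) (m : nat) (alg : online_algorithm R m)
    (I : seq (job R)) (J : job R) :
  run alg (rcons I J) = schedule_job alg (run alg I) J.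
Proof. by rewrite /run foldl_rcons. Qed.

Lemma load_schedule_job (R : realType) (m : nat) (test : R -> R -> bool)
    (sel : machine_rule R m) (h : history R m) (J : job R) (i : 'I_m) :
  load (schedule_job (list_algorithm test sel) h J) i =
  load h i + (if sel h (job_u J) (job_t J) == i then job_cost test J else 0).
Proof.
rewrite /load /schedule_job /list_algorithm -cats1 big_cat big_cons big_nil /=.
rewrite /occupied_time /job_cost addr0 /=.
by case: (sel h _ _ == i) => //; case: (test _ _).
Qed.

Lemma sum_load (R : realType) (m : nat) (test : R -> R -> bool)
    (sel : machine_rule R m) (I : seq (job R)) :
  \sum_(i < m) load (run (list_algorithm test sel) I) i =
  \sum_(J <- I) job_cost test J.
Proof.
elim/last_ind: I => [|I J IH].
  by rewrite big_nil big1// => i _; rewrite /load /= big_nil.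
rewrite run_rcons -cats1 big_cat big_cons big_nil /= addr0 -IH.
under eq_bigr do rewrite load_schedule_job.
rewrite big_split /= -big_mkcond /=; congr (_ + _).
by set i0 := sel _ _ _; rewrite (big_pred1 i0)// => i; rewrite eq_sym.
Qed.

(* [k] is the job that completes last on the most loaded machine: when it
   arrives, the least loaded machine carries at most half of the previous load. *)
Lemma list_scheduling_bound (R : realType) (test : R -> R -> bool)
    (sel : machine_rule R 2) (hsel : least_loaded_rule sel) (J0 : job R)
    (I : seq (job R)) : (0 < size I)%N ->
  exists2 k, (k < size I)%N &
    2 * makespan (list_algorithm test sel) I <=
    \sum_(0 <= j < k.+1) job_cost test (nth J0 I j) +
    job_cost test (nth J0 I k).
Proof.
elim/last_ind: I => [//|I J IH] _.
set alg := list_algorithm test sel in IH *.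
set c := job_cost test J.
set i0 := sel (run alg I) (job_u J) (job_t J).
have prefixE k : (k < size I)%N ->
    \sum_(0 <= j < k.+1) job_cost test (nth J0 (rcons I J) j) =
    \sum_(0 <= j < k.+1) job_cost test (nth J0 I j).
  move=> kI; apply: eq_big_nat => j /andP[_ jk].
  by rewrite nth_rcons (leq_trans jk).
have c0 : 0 <= c by exact: job_cost_ge0.
have loadE i : load (run alg (rcons I J)) i =
    load (run alg I) i + (if i0 == i then c else 0).
  by rewrite run_rcons load_schedule_job.
have last_bound : 2 * (load (run alg I) i0 + c) <=
    \sum_(0 <= j < (size I).+1) job_cost test (nth J0 (rcons I J) j) +
    job_cost test (nth J0 (rcons I J) (size I)).
  have -> : nth J0 (rcons I J) (size I) = J by rewrite nth_rcons ltnn eqxx.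
  rewrite -(size_rcons I J) -(big_nth J0 xpredT (job_cost test)).
  rewrite -cats1 big_cat big_cons big_nil /= addr0 -(sum_load test sel I) /=.
  rewrite !big_ord_recl big_ord0 -/alg -/c.
  have := hsel (run alg I) (job_u J) (job_t J) ord0.
  have := hsel (run alg I) (job_u J) (job_t J) (lift ord0 ord0).
  by rewrite -/i0; lra.
(* Only the load of machine [i0] changes, so either [J] becomes the critical job or the makespan
   does not exceed the one before [J] arrived. *)
have : makespan alg (rcons I J) <=
    Num.max (load (run alg I) i0 + c) (makespan alg I).
  apply: bigmax_le => [|i _]; first by rewrite le_max makespan_ge0 orbT.
  rewrite loadE le_max; case: eqP => [<-|_]; first by rewrite lexx.
  by rewrite addr0 load_le_makespan orbT.
rewrite le_max => /orP[new_le|old].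
  by exists (size I); rewrite ?size_rcons//; apply: le_trans last_bound; lra.
(* An empty [I] has no critical job to inherit; here the makespan is 0 and [k = 0] works
   trivially. *)
case: (posnP (size I)) => [/size0nil I0|].
  exists 0%N; first by rewrite size_rcons.
  apply: (@le_trans _ _ 0).
    suff -> : makespan alg (rcons I J) = 0 by rewrite mulr0.
    apply/eqP; rewrite eq_le makespan_ge0 andbT (le_trans old)//.
    rewrite I0; apply: bigmax_le => // i _.
    by rewrite /load big_nil.
  apply: addr_ge0; last exact: job_cost_ge0.
  by apply: sumr_ge0 => j _; exact: job_cost_ge0.
move=> /IH[k kI hk].
exists k; first by rewrite size_rcons ltnS ltnW.
by rewrite prefixE// nth_rcons kI; lra.
Qed.

(** * Lower bounds on the optimal makespan: average load and single jobs *)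

Definition zero_job (R : realType) : job R :=
  @Job R 0 0 0 (lexx 0) (lexx 0) (introT andP (conj (lexx 0) (lexx 0))).

Lemma optimal_makespan_ge (R : realType) (I : seq (job R)) (J0 : job R) :
  \sum_(0 <= j < size I) job_rho (nth J0 I j) <= 2 * optimal_makespan 2 I /\
  forall k, (k < size I)%N -> job_rho (nth J0 I k) <= optimal_makespan 2 I.
Proof.
have nonempty : ([set @assignment_makespan R 2 I a |
    a in [set: {ffun 'I_(size I) -> 'I_2}]] !=set0)%classic.
  by apply: image_nonempty; exists [ffun=> ord0].
have machine_le (a : {ffun 'I_(size I) -> 'I_2}) i :
    \sum_(j < size I | a j == i) job_rho (tnth (in_tuple I) j) <=
    assignment_makespan a.
  exact: (le_bigmax _ (fun i =>
    \sum_(j < size I | a j == i) job_rho (tnth (in_tuple I) j))).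
split.
  suff : (\sum_(0 <= j < size I) job_rho (nth J0 I j)) / 2 <=
    optimal_makespan 2 I by lra.
  apply: lb_le_inf => // _ [a _ <-].
  have := machine_le a ord0; have := machine_le a (lift ord0 ord0).
  suff -> : \sum_(0 <= j < size I) job_rho (nth J0 I j) =
    \sum_(j < size I | a j == ord0) job_rho (tnth (in_tuple I) j) +
    \sum_(j < size I | a j == lift ord0 ord0) job_rho (tnth (in_tuple I) j) by lra.
  rewrite big_mkord (bigID (fun j => a j == ord0)) /=; congr (_ + _).
    by apply: eq_bigr => j _; rewrite (tnth_nth J0).
  apply: eq_big => [j|j _]; last by rewrite (tnth_nth J0).
  by case: (a j) => -[|[|]].
move=> k kI; apply: lb_le_inf => // _ [a _ <-].
apply: le_trans (machine_le a (a (Ordinal kI))).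
rewrite (bigD1 (Ordinal kI))//= (tnth_nth J0) /= lerDl.
by apply: sumr_ge0 => j _; exact: job_rho_ge0.
Qed.

(** * Combining the critical jobs of the two algorithms *)

Lemma critical_jobs_bound (R : realType) (a b x opt : R) (c0 c1 rho : nat -> R)
    (n k0 k1 : nat) :
  1 / 2 <= a -> 0 <= b -> 1 <= x -> 2 - a <= x -> a <= x -> x <= 2 ->
  (forall j, [/\ 0 <= c0 j, 0 <= c1 j & 0 <= rho j]) ->
  (forall j, a * c0 j + b * c1 j <= x * rho j) ->
  (forall j, a * c0 j <= rho j) ->
  (forall j, b * c1 j <= (x - a) * rho j) ->
  \sum_(0 <= j < n) rho j <= 2 * opt ->
  (forall j, (j < n)%N -> rho j <= opt) ->
  (k0 < n)%N -> (k1 < n)%N ->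
  a * (\sum_(0 <= j < k0.+1) c0 j + c0 k0) +
  b * (\sum_(0 <= j < k1.+1) c1 j + c1 k1) <= 3 * x * opt.
Proof.
move=> a2 b0 x_ge1 ax2 ax x2 nonneg hx h0 h1 sum_opt rho_opt k0n k1n.
have c0_ge0 j : 0 <= c0 j by case: (nonneg j).
have c1_ge0 j : 0 <= c1 j by case: (nonneg j).
have rho_ge0 j : 0 <= rho j by case: (nonneg j).
have mono (c : nat -> R) i j : (forall l, 0 <= c l) -> (i <= j)%N ->
    \sum_(0 <= l < i) c l <= \sum_(0 <= l < j) c l.
  move=> c_ge0 ij; rewrite (big_cat_nat (leq0n i) ij)//= lerDl.
  by apply: sumr_ge0.
have prefix k : a * \sum_(0 <= j < k) c0 j + b * \sum_(0 <= j < k) c1 j <=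
    x * \sum_(0 <= j < k) rho j.
  by rewrite !mulr_sumr -big_split; apply: ler_sum_nat => j _ /=.
have rho_prefix k : (k < n)%N -> \sum_(0 <= j < k) rho j <= 2 * opt - rho k.
  move=> kn; have := mono rho _ _ rho_ge0 kn.
  by rewrite big_nat_recr//=; lra.
have a0 : 0 <= a by lra.
have := h0 k0; have := h1 k1; have := rho_opt _ k0n; have := rho_opt _ k1n.
have := rho_ge0 k0; have := rho_ge0 k1.
case: (ltngtP k0 k1) => [k01|k10|k01].
(* Up to [k1] excluded, both sums together weigh at most [x * (2 * opt - rho k1)]. The remaining
   terms [rho k0] and [2 * (x - a) * rho k1] bring the excess over [2 * x * opt] to
   [rho k0 + (x - 2 * a) * rho k1], which is at most [x * opt] because [2 * a >= 1]. *)
- have := mono c0 _ _ c0_ge0 k01.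
  move: (prefix k1) (rho_prefix _ k1n).
  clear mono prefix rho_prefix hx h0 h1 c0_ge0 c1_ge0 rho_ge0 nonneg rho_opt.
  rewrite [\sum_(0 <= j < k1.+1) _]big_nat_recr//=; nra.
(* Now the excess over [2 * x * opt] is [(2 - x) * rho k0 + (x - a) * rho k1]. Both coefficients are
   nonnegative, so it is at most [(2 - a) * opt], hence at most [x * opt]. *)
- have := mono c1 _ _ c1_ge0 k10.
  move: (prefix k0) (rho_prefix _ k0n).
  clear mono prefix rho_prefix hx h0 h1 c0_ge0 c1_ge0 rho_ge0 nonneg rho_opt.
  rewrite [\sum_(0 <= j < k0.+1) _]big_nat_recr//=; nra.
(* With a common critical job, [hx] counted twice leaves an excess of only [x * rho k0]. *)
- subst k1; move: (prefix k0) (rho_prefix _ k0n) (hx k0).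
  clear mono prefix rho_prefix hx h0 h1 c0_ge0 c1_ge0 rho_ge0 nonneg rho_opt.
  rewrite !big_nat_recr//=; nra.
Qed.

(** * The constants, and the cost of a single job under the two testing rules *)

Definition test0 (R : realType) (u t : R) : bool :=
  ~~ (job_ratio u t <= (golden_ratio R)%:E)%E.

Definition test1 (R : realType) (u t : R) : bool :=
  ~~ ((job_ratio u t <= (x1 R)%:E) ||
      ((golden_ratio R)%:E < job_ratio u t <= (y1 R)%:E))%E.

Lemma job_ratio_le (R : realType) (u t x : R) : 0 <= u -> 0 <= t -> 0 <= x ->
  (job_ratio u t <= x%:E)%E = (u <= x * t).
Proof.
move=> u0 t0 x_ge0; rewrite /job_ratio; case: (eqVneq t 0) => [->|tn0].
  rewrite mulr0; case: ltP => [u_gt0|u_le0].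
    by rewrite leye_eq.
  by rewrite lee_fin x_ge0.
by rewrite lee_fin ler_pdivrMr// lt_neqAle eq_sym tn0.
Qed.

Lemma golden_ratio_sqr (R : realType) :
  golden_ratio R ^+ 2 = golden_ratio R + 1.
Proof.
have := @sqr_sqrtr R 5 ltac:(by rewrite ler0n).
by rewrite /golden_ratio; set s := Num.sqrt 5; lra.
Qed.

Lemma golden_ratio_bounds (R : realType) : 8 / 5 <= golden_ratio R <= 81 / 50.
Proof.
have : 0 <= golden_ratio R.
  by rewrite /golden_ratio divr_ge0// addr_ge0// sqrtr_ge0.
have := golden_ratio_sqr R; set phi := golden_ratio R => h h0.
by apply/andP; split; nra.
Qed.

(** Since [phi^2 = phi + 1], the radicand [13 - 7 * phi] is the discriminant of
    [X^2 - phi * X + 2 * phi - 3], whose larger root is [x1]. *)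
Lemma x1_sqr (R : realType) :
  x1 R ^+ 2 = golden_ratio R * x1 R - 2 * golden_ratio R + 3.
Proof.
have /andP[_ h] := golden_ratio_bounds R; have := golden_ratio_sqr R.
have := @sqr_sqrtr R (13 - 7 * golden_ratio R) ltac:(lra).
by rewrite /x1; set s := Num.sqrt _; lra.
Qed.

(** The value 7/5 is chosen so that [2 - alpha <= x1], as [alpha >= 3/5]. *)
Lemma x1_bounds (R : realType) : 7 / 5 <= x1 R <= golden_ratio R.
Proof.
have := golden_ratio_sqr R; have /andP[h1 h2] := golden_ratio_bounds R.
have h3 := @sqr_sqrtr R (13 - 7 * golden_ratio R) ltac:(lra).
have : 0 <= Num.sqrt (13 - 7 * golden_ratio R) by exact: sqrtr_ge0.
move: h3; rewrite /x1; set s := Num.sqrt _ => h3 h4 h5.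
by apply/andP; split; nra.
Qed.

Lemma x1_y1 (R : realType) : (x1 R - 1) * y1 R = 1.
Proof. by have /andP[h _] := x1_bounds R; rewrite /y1 divff//; lra. Qed.

(* The defining property of [x1]: the expected ratio [alpha + (1 - alpha) * y1]
   of a job with ratio [y1] and zero processing time, which only [A0] tests,
   equals [x1], the common ratio of an untested job with [u = x1 * t]. *)
Lemma y1_x1 (R : realType) : (1 - alpha R) * y1 R = x1 R - alpha R.
Proof.
have /andP[h _] := x1_bounds R.
have : x1 R - 1 != 0 by lra.
move=> h0; apply: (mulfI h0); rewrite mulrCA x1_y1 mulr1 /alpha.
by have := x1_sqr R; lra.
Qed.

Lemma alpha_golden (R : realType) : alpha R * golden_ratio R = 1.
Proof. by have := golden_ratio_sqr R; rewrite /alpha; lra. Qed.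

(** An untested job of ratio at most [r] costs at most [r * rho]; a tested one of ratio at least [r]
    costs at most [(1 + 1/r) * rho]. The thresholds fit together through [1 + 1/phi = phi],
    [1 + 1/y1 = x1] and [1 + 1/x1 <= y1]. The rules agree for ratios up to [x1] or above [y1] (first
    case); in between, the other two cases depend on whether [u <= t + p]. *)
Lemma job_cost_cases (R : realType) (J : job R) :
  let q0 := job_cost (@test0 R) J in
  let q1 := job_cost (@test1 R) J in
  let rho := job_rho J in
  [\/ q0 <= x1 R * rho /\ q1 <= x1 R * rho,
      q0 <= golden_ratio R * rho /\ q1 <= rho |
      q0 <= rho /\ q1 <= y1 R * rho].
Proof.
case: J => u t p u0 t0 p_bounds; have /andP[p0 pu] := p_bounds.
rewrite /job_cost /job_rho /test0 /test1 /=.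
have /andP[x_ge x_le] := x1_bounds R.
have /andP[phi_ge phi_le] := golden_ratio_bounds R.
have phi2 := golden_ratio_sqr R.
have xy := x1_y1 R.
have y_ge1 : 1 <= y1 R by nra.
rewrite ltNge !job_ratio_le; try lra.
set phi := golden_ratio R in phi2 phi_ge phi_le x_le *.
set x := x1 R in xy x_ge x_le *; set y := y1 R in xy y_ge1 *.
have y_ge : x <= y.
  apply: (le_trans x_le).
  have : (x - 1) * phi <= (x - 1) * y by rewrite xy; nra.
  by rewrite ler_pM2l//; lra.
have grow (c v : R) : 1 <= c -> 0 <= v -> v <= c * v.
  by move=> *; rewrite ler_peMl.
have [xu xt xp] : [/\ u <= x * u, t <= x * t & p <= x * p].
  by split; apply: grow => //; lra.
have [phit phip] : t <= phi * t /\ p <= phi * p.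
  by split; apply: grow => //; lra.
have yp : p <= y * p by exact: grow.
have [ux|ux] := leP u (x * t) => /=.
  have -> /= : u <= phi * t by apply: (le_trans ux); exact: ler_wpM2r.
  by apply: Or31; case: (leP u (t + p)) => ?; split; lra.
have [uphi|uphi] /= := leP u (phi * t).
  case: (leP u (t + p)) => ?; last by apply: Or32; split; lra.
  apply: Or33; split=> //.
  have : (y - 1) * (x * t) <= (y - 1) * u by rewrite ler_wpM2l; lra.
  have -> : (y - 1) * (x * t) = (x - 1) * y * t + (y - x) * t by ring.
  have : 0 <= (y - x) * t by rewrite mulr_ge0 ?subr_ge0.
  by rewrite xy; lra.
have [uy|uy] /= := leP u (y * t).
  case: (leP u (t + p)) => ?; last by apply: Or33; split; lra.
  apply: Or32; split=> //.
  have : (phi - 1) * (phi * t) <= (phi - 1) * u by rewrite ler_wpM2l; lra.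
  have -> : (phi - 1) * (phi * t) = (phi ^+ 2 - phi) * t by ring.
  by rewrite phi2; lra.
apply: Or31; case: (leP u (t + p)) => ?; last by split; lra.
have : (x - 1) * (y * t) <= (x - 1) * u by rewrite ler_wpM2l; lra.
by rewrite mulrA xy; split; lra.
Qed.

(** As [alpha * phi = 1], the three cases weigh in total at most [x1], [1 + (1 - alpha)] and
    [alpha + (x1 - alpha)] times [rho]; [2 - alpha <= x1] settles the second. *)
Lemma job_cost_mix (R : realType) (J : job R) :
  let c0 := alpha R * job_cost (@test0 R) J in
  let c1 := (1 - alpha R) * job_cost (@test1 R) J in
  let rho := job_rho J in
  [/\ c0 + c1 <= x1 R * rho, c0 <= rho & c1 <= (x1 R - alpha R) * rho].
Proof.
have /andP[x_ge x_le] := x1_bounds R.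
have /andP[phi_ge phi_le] := golden_ratio_bounds R.
have alphaE : alpha R = golden_ratio R - 1 by [].
have a0 : 0 <= alpha R by lra.
have b0 : 0 <= 1 - alpha R by lra.
have rho0 := job_rho_ge0 J.
have ax : alpha R * x1 R * job_rho J <= 1 * job_rho J.
  by rewrite ler_wpM2r// -(alpha_golden R) ler_wpM2l.
have xa : alpha R * 1 * job_rho J <= alpha R * x1 R * job_rho J.
  by rewrite ler_wpM2r// ler_wpM2l//; lra.
have a_le : alpha R * job_rho J <= 1 * job_rho J by rewrite ler_wpM2r//; lra.
have x_lb c : c <= 7 / 5 -> c * job_rho J <= x1 R * job_rho J.
  by move=> c_le; rewrite ler_wpM2r//; lra.
have x1_lb := x_lb 1 ltac:(lra).
have x2_lb := x_lb (2 - alpha R) ltac:(lra).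
move=> c0 c1 rho.
case: (job_cost_cases J) => -[/(ler_wpM2l a0) h0 /(ler_wpM2l b0) h1].
- by split; rewrite /c0 /c1 /rho; lra.
- rewrite mulrA alpha_golden in h0.
  by split; rewrite /c0 /c1 /rho; lra.
- rewrite mulrA y1_x1 in h1.
  by split; rewrite /c0 /c1 /rho; lra.
Qed.

(** * The upper bound on the expected makespan *)

Lemma expected_makespan_A (R : realType) (sel0 sel1 : machine_rule R 2)
    (I : seq (job R)) :
  expected_makespan (algorithm_A sel0 sel1) I =
  (alpha R * makespan (list_algorithm (@test0 R) sel0) I +
   (1 - alpha R) * makespan (list_algorithm (@test1 R) sel1) I)%:E.
Proof.
rewrite /expected_makespan unlock /algorithm_A /=.
(* [algorithm_A0] and [algorithm_A1] are convertible to the list algorithms for [test0] and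
   [test1]. *)
rewrite integral_bernoulli_prob ?alpha_itv//.
by move=> b; rewrite lee_fin makespan_ge0.
Qed.

Lemma expected_makespan_le (R : realType) (sel0 sel1 : machine_rule R 2)
    (hsel0 : least_loaded_rule sel0) (hsel1 : least_loaded_rule sel1)
    (I : seq (job R)) :
  2 * (alpha R * makespan (list_algorithm (@test0 R) sel0) I +
       (1 - alpha R) * makespan (list_algorithm (@test1 R) sel1) I) <=
  3 * x1 R * optimal_makespan 2 I.
Proof.
case: I => [|J0 I'].
  have [] := @optimal_makespan_ge R [::] (zero_job R).
  have makespan_nil alg : @makespan R 2 alg [::] = 0.
    apply/eqP; rewrite eq_le makespan_ge0 andbT.
    by apply: bigmax_le => // i _; rewrite /load big_nil.
  rewrite !makespan_nil big_nil; have /andP[x_ge _] := x1_bounds R.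
  by rewrite !mulr0 addr0 mulr0 => opt_ge0 _; rewrite mulr_ge0//; lra.
set I := J0 :: I'; have I0 : (0 < size I)%N by [].
have [sum_opt rho_opt] := optimal_makespan_ge I J0.
have [k0 k0I h0] := list_scheduling_bound (@test0 R) hsel0 J0 I0.
have [k1 k1I h1] := list_scheduling_bound (@test1 R) hsel1 J0 I0.
have /andP[x_ge x_le] := x1_bounds R.
have /andP[phi_ge phi_le] := golden_ratio_bounds R.
have alphaE : alpha R = golden_ratio R - 1 by [].
have mix j := job_cost_mix (nth J0 I j).
have ge0 j : [/\ 0 <= job_cost (@test0 R) (nth J0 I j),
    0 <= job_cost (@test1 R) (nth J0 I j) & 0 <= job_rho (nth J0 I j)].
  by split; rewrite ?job_cost_ge0 ?job_rho_ge0.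
rewrite mulrDr !(mulrCA 2).
apply: (@le_trans _ _ (alpha R *
    (\sum_(0 <= j < k0.+1) job_cost (@test0 R) (nth J0 I j) +
     job_cost (@test0 R) (nth J0 I k0)) + (1 - alpha R) *
    (\sum_(0 <= j < k1.+1) job_cost (@test1 R) (nth J0 I j) +
     job_cost (@test1 R) (nth J0 I k1)))).
  by apply: lerD; apply: ler_wpM2l => //; lra.
by apply: (critical_jobs_bound _ _ _ _ _ _ ge0 _ _ _ sum_opt rho_opt k0I k1I);
  [lra..| | |]; move=> j; case: (mix j).
Qed.

(** * The tight instance and the conclusion *)

(** However ties are broken, the two copies of [J] land on different machines, so [K] is added to a
    load of [q]. *)
Lemma tight_makespan (R : realType) (test : R -> R -> bool)
    (sel : machine_rule R 2) (hsel : least_loaded_rule sel) (J K : job R)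
    (q : R) : 0 < q -> job_cost test J = q -> job_cost test K = 2 * q ->
  3 * q <= makespan (list_algorithm test sel) [:: J; J; K].
Proof.
move=> q0 Jq Kq; set alg := list_algorithm test sel.
set h1 := schedule_job alg [::] J; set h2 := schedule_job alg h1 J.
set i1 := sel [::] (job_u J) (job_t J); set i2 := sel h1 (job_u J) (job_t J).
set i3 := sel h2 (job_u K) (job_t K).
have load1 i : load h1 i = if i1 == i then q else 0.
  by rewrite load_schedule_job Jq [load _ _]big_nil add0r.
have load2 i : load h2 i = load h1 i + (if i2 == i then q else 0).
  by rewrite load_schedule_job Jq.
have load3 : load (run alg [:: J; J; K]) i3 = load h2 i3 + 2 * q.
  by rewrite /= load_schedule_job Kq -/i3 eqxx.
apply: le_trans (load_le_makespan alg [:: J; J; K] i3).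
rewrite load3 load2 !load1.
have := hsel h1 (job_u J) (job_t J); rewrite -/i2.
move=> least; have := least ord0; have := least (lift ord0 ord0).
rewrite !load1.
(* Choices with [i1 = i2] contradict [least], since the other machine is still empty and [0 < q]. *)
move: (i1) (i2) (i3) => [[|[|//]] ?] [[|[|//]] ?] [[|[|//]] ?].
all: by rewrite /eq_op /=; lra.
Qed.

Definition tight_job (R : realType) (s : R) (s_ge0 : 0 <= s)
    (u_ge0 : 0 <= x1 R * s) : job R :=
  @Job R (x1 R * s) s 0 u_ge0 s_ge0 (introT andP (conj (lexx 0) u_ge0)).

Theorem theorem2 (R : realType) (sel0 sel1 : machine_rule R 2)
    (hsel0 : least_loaded_rule sel0) (hsel1 : least_loaded_rule sel1) :
  let phi : R := golden_ratio R in
  let c : R := (3 * phi + 3 * Num.sqrt (13 - 7 * phi)) / 4 in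
  let A := algorithm_A sel0 sel1 in
  (expected_competitive_ratio A <= c%:E)%E /\
  exists I : seq (job R),
    0 < optimal_makespan 2 I /\ performance_ratio A I = c%:E.
Proof.
move=> phi c A.
have cE : c = 3 / 2 * x1 R by rewrite /c /x1 -/phi; lra.
have /andP[x_ge x_le] := x1_bounds R.
have /andP[phi_ge phi_le] := golden_ratio_bounds R.
have [a_ge0 b_ge0] : 0 <= alpha R /\ 0 <= 1 - alpha R.
  by rewrite /alpha; split; lra.
split.
  apply: ge_ereal_sup => _ [I _ <-].
  rewrite /performance_ratio expected_makespan_A.
  have := expected_makespan_le hsel0 hsel1 I; set e := _ + _ => e_le.
  have e_ge0 : 0 <= e.
    by apply: addr_ge0; apply: mulr_ge0 => //; exact: makespan_ge0.
  (* A zero optimum has inverse [+oo], but then [e = 0] and the product is 0. *)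
  rewrite inver; case: eqP => [opt0|/eqP opt0].
    have -> : e = 0 by move: e_le; rewrite opt0; lra.
    by rewrite mul0e lee_fin cE; lra.
  have opt_gt0 : 0 < optimal_makespan 2 I.
    by rewrite lt_neqAle eq_sym opt0/=; nra.
  by rewrite -EFinM lee_fin ler_pdivrMr// cE; lra.
have u_ge0 (s : R) : 0 <= s -> 0 <= x1 R * s.
  by move=> s0; rewrite mulr_ge0//; lra.
pose J := tight_job (@ler01 R) (u_ge0 1 (@ler01 R)).
pose K := tight_job (ler0n R 2) (u_ge0 _ (ler0n R 2)).
pose I := [:: J; J; K].
have rhoJ : job_rho J = 1 by rewrite /job_rho /=; case: leP; lra.
have rhoK : job_rho K = 2 by rewrite /job_rho /=; case: leP; lra.
have opt : optimal_makespan 2 I = 2.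
  apply/eqP; rewrite eq_le; apply/andP; split; last first.
    by have [_ /(_ 2%N isT)] := optimal_makespan_ge I J; rewrite /= rhoK.
  (* Both copies of [J] share one machine and [K] has the other: each carries exactly 2. *)
  pose a := [ffun j : 'I_(size I) =>
    if (j < 2)%N then ord0 else ord_max : 'I_2].
  apply: (@le_trans _ _ (assignment_makespan a)).
    apply: ge_inf; last by exists a.
    by exists 0 => _ [a' _ <-]; exact: bigmax_ge_id.
  apply: bigmax_le => // i _.
  rewrite big_mkcond /= !big_ord_recl big_ord0 !ffunE /= !(tnth_nth J) /=.
  rewrite rhoJ rhoK.
  by case: i => [[|[|//]] ?]; rewrite /eq_op /=; lra.
have cost0 (s : R) (s0 : 0 <= s) :
    job_cost (@test0 R) (tight_job s0 (u_ge0 s s0)) = x1 R * s.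
  rewrite /job_cost /test0 /= job_ratio_le ?u_ge0//; last by lra.
  by rewrite ler_wpM2r.
have cost1 (s : R) (s0 : 0 <= s) :
    job_cost (@test1 R) (tight_job s0 (u_ge0 s s0)) = x1 R * s.
  by rewrite /job_cost /test1 /= job_ratio_le ?u_ge0 ?lexx//; lra.
exists I; split; first by rewrite opt.
rewrite /performance_ratio expected_makespan_A opt inver pnatr_eq0 /= -EFinM.
congr EFin; apply/eqP; rewrite eq_le; apply/andP; split.
  have := expected_makespan_le hsel0 hsel1 I; rewrite opt cE.
  by set e := _ + _; lra.
have x_gt0 : 0 < x1 R by lra.
have m0 : 3 * x1 R <= makespan (list_algorithm (@test0 R) sel0) I.
  by apply: tight_makespan => //; rewrite cost0; lra.
have m1 : 3 * x1 R <= makespan (list_algorithm (@test1 R) sel1) I.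
  by apply: tight_makespan => //; rewrite cost1; lra.
have := ler_wpM2l a_ge0 m0; have := ler_wpM2l b_ge0 m1.
by rewrite cE; set e0 := makespan _ _; set e1 := makespan _ _; lra.
Qed.
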